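(* Let $(\bar p,\bar x)\in\mathbb{P}\times\mathbb{X}$. Suppose that: (i) $\bar x\in\mathcal{S}(\bar p)$; (ii) the set-valued mapping $p\mapsto F(p,\bar x)$ is Hausdorff $C$-u.s.c. at $\bar p$; (iii) there exists $\delta_1>0$ such that for every $p\in \mathrm{B}(\bar p,\delta_1)$ the set-valued mapping $x\mapsto F(p,x)$ is l.s.c. on $\mathbb{X}$; (iv) there exists $\delta_2>0$ such that, for every $p\in \mathrm{B}(\bar p,\delta_2)$, the set-valued mapping $x\mapsto F(p,x)$ admits an outer prederivative $H_{F(p,\cdot)}(x;\cdot):\mathbb{X}\rightrightarrows\mathbb{Y}$ at each point $x\in \mathrm{B}(\bar x,\delta_2)$, such that $$\sigma_H(\bar p,\bar x)=\inf\{\sigma_{H_{F(p,\cdot)}}(x)\ |\ (p,x)\in [\mathrm{B}(\bar p,\delta_2)\times \mathrm{B}(\bar x,\delta_2)]\setminus\mathrm{graph}\,\mathcal{S}\}>0;$$ (v) $F$ admits an outer prederivative $H_F((\bar p,\bar x);\cdot):\mathbb{P}\times\mathbb{X}\rightrightarrows\mathbb{Y}$ at $(\bar p,\bar x)$. Then $$\mathrm{D}\mathcal{S}(\bar p,\bar x)(p)\supseteq \{v\in\mathbb{X}\ |\ H_F((\bar p,\bar x);(p,v))\subseteq C\},\qquad\forall p\in\mathbb{P}.$$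
   Context: Standing assumptions: $(\mathbb{P},\|\cdot\|)$ and $(\mathbb{Y},\|\cdot\|)$ are normed vector spaces, $(\mathbb{X},\|\cdot\|)$ is a Banach space, $\mathbb{P}\times\mathbb{X}$ carries the max-norm, $C\subset\mathbb{Y}$ is a closed convex cone with $\mathrm{int}\,C\ne\varnothing$, and $F:\mathbb{P}\times\mathbb{X}\rightrightarrows\mathbb{Y}$ is a set-valued mapping with nonempty values everywhere. The solution mapping $\mathcal{S}:\mathbb{P}\rightrightarrows\mathbb{X}$ of the parameterized set-valued inclusion $F(p,x)\subseteq C$ is $\mathcal{S}(p)=\{x\in\mathbb{X}\ |\ F(p,x)\subseteq C\}$; $\mathrm{graph}\,\mathcal{S}=\{(p,x)\ |\ x\in\mathcal{S}(p)\}$. Notation: $\mathrm{B}(x,r)$ is the closed ball with center $x$ and radius $r$; $\mathbb{B}$ is the closed unit ball and $\mathbb{S}$ the unit sphere of the relevant space; $\mathrm{dist}(x,S)=\inf_{z\in S}\|x-z\|$, $\mathrm{B}(S,r)=\{x\ |\ \mathrm{dist}(x,S)\le r\}$; $\inf\varnothing=+\infty$, $\sup\varnothing=-\infty$. A set-valued mapping $\Phi$ is l.s.c. at $x_0$ if for every open $V$ with $\Phi(x_0)\cap V\ne\varnothing$ there is a neighbourhood $U$ of $x_0$ with $\Phi(x)\cap V\neq\varnothing$ for all $x\in U$. $\Phi$ is Hausdorff $C$-u.s.c. at $x_0$ if for every $\epsilon>0$ there is $\delta>0$ such that $\Phi(x)\subseteq \mathrm{B}(\Phi(x_0)+C,\epsilon)$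 for all $x\in \mathrm{B}(x_0,\delta)$. A set-valued mapping $H$ is positively homogeneous if $H(tx)=tH(x)$ for all $t>0$. A positively homogeneous mapping $H_\Phi(x_0;\cdot):\mathbb{V}\rightrightarrows\mathbb{Y}$ is an outer prederivative of $\Phi:\mathbb{V}\rightrightarrows\mathbb{Y}$ ($\mathbb{V}$ a normed space) at $x_0$ if for every $\epsilon>0$ there is $\delta>0$ such that $\Phi(x)\subseteq \Phi(x_0)+H_\Phi(x_0;x-x_0)+\epsilon\|x-x_0\|\mathbb{B}$ for all $x\in \mathrm{B}(x_0,\delta)$. For $K,S\subseteq\mathbb{Y}$, $K{*\over{}}S=\{y\in\mathbb{Y}\ |\ y+S\subseteq K\}$ and $|K{*\over{}}S|=\sup\{r>0\ |\ r\mathbb{B}\subseteq K{*\over{}}S\}$. Then $\sigma_{H_{F(p,\cdot)}}(x)=\sup_{u\in\mathbb{S}}\,|C{*\over{}}H_{F(p,\cdot)}(x;u)|$, with $u$ ranging over the unit sphere of $\mathbb{X}$. The contingent cone to a set $S$ at $y\in S$ is $\mathrm{T}(S;y)=\{v\ |\ \liminf_{t\downarrow0}\mathrm{dist}(y+tv,S)/t=0\}$. The graphical (contingent) derivative of $\mathcal{S}$ at $(\bar p,\bar x)\in\mathrm{graph}\,\mathcal{S}$ is the set-valued mapping $\mathrm{D}\mathcal{S}(\bar p,\bar x):\mathbb{P}\rightrightarrows\mathbb{X}$ with $\mathrm{graph}\,\mathrm{D}\mathcal{S}(\bar p,\bar x)=\mathrm{T}(\mathrm{graph}\,\mathcal{S};(\bar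 p,\bar x))$. *)

(* Defs.v *)
From HB Require Import structures.
From mathcomp Require Import all_boot all_order all_algebra.
From mathcomp Require Import all_classical all_reals all_analysis.

Set Implicit Arguments.
Unset Strict Implicit.
Unset Printing Implicit Defensive.

Import Order.TTheory GRing.Theory Num.Def Num.Theory.
Import numFieldNormedType.Exports.

Local Open Scope classical_set_scope.
Local Open Scope ring_scope.

(* A set-valued mapping from V to Y is a function V -> set Y.  The closed ball
   B(x, r) is the library's closed_ball_ normr x r = [set y | `|x - y| <= r];
   closed_ball is the closure of the open ball, which differs at r = 0.  The
   canonical norm of a product of normed modules is the max-norm. *)

Section SetOperations.
Context {R : realType} {Y : normedModType R}.

Definition set_add (A B : set Y) : set Y := [set a + b | a in A & b in B].

Definition set_scale (t : R) (A : set Y) : set Y := [set t *: a | a in A].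

Definition unit_ball : set Y := closed_ball_ normr 0 1.

Definition unit_sphere : set Y := [set u | `|u| = 1].

Definition dist_set (y : Y) (S : set Y) : \bar R :=
  ereal_inf [set `|y - z|%:E | z in S].

Definition enlargement (S : set Y) (r : R) : set Y :=
  [set y | (dist_set y S <= r%:E)%E].

(* Positive factors only, as for positively homogeneous mappings; a nonempty
   closed set with this property contains 0. *)
Definition is_cone (C : set Y) : Prop :=
  forall (t : R) (y : Y), 0 < t -> C y -> C (t *: y).

Definition star_diff (K S : set Y) : set Y :=
  [set y | set_add [set y] S `<=` K].

Definition inner_radius (K : set Y) : \bar R :=
  ereal_sup [set r%:E | r in [set r : R | 0 < r /\ set_scale r unit_ball `<=` K]].

Definition contingent_cone (S : set Y) (y : Y) : set Y :=
  [set v | limf_einf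
             (fun t : R => (dist_set (y + t *: v)%R S * (t^-1)%R%:E)%E) 0^'+ = 0%E].

End SetOperations.

Section SetValuedMappings.
Context {R : realType} {V Y : normedModType R}.
Implicit Types Phi H : V -> set Y.

Definition graph_of Phi : set (V * Y) := [set z | Phi z.1 z.2].

Definition lsc_at Phi (x0 : V) : Prop :=
  forall O : set Y, open O -> Phi x0 `&` O !=set0 ->
    \forall x \near x0, Phi x `&` O !=set0.

Definition hausdorff_usc_at (C : set Y) Phi (x0 : V) : Prop :=
  forall eps : R, 0 < eps ->
    exists2 delta : R, 0 < delta &
      forall x, closed_ball_ normr x0 delta x ->
        Phi x `<=` enlargement (set_add (Phi x0) C) eps.

Definition positively_homogeneous H : Prop :=
  forall (t : R) (x : V), 0 < t -> H (t *: x) = set_scale t (H x).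

Definition outer_prederivative Phi (x0 : V) H : Prop :=
  positively_homogeneous H /\
  forall eps : R, 0 < eps ->
    exists2 delta : R, 0 < delta &
      forall x, closed_ball_ normr x0 delta x ->
        Phi x `<=` set_add (set_add (Phi x0) (H (x - x0)))
                           (set_scale (eps * `|x - x0|) unit_ball).

Definition sigma_prederivative (C : set Y) H : \bar R :=
  ereal_sup [set inner_radius (star_diff C (H u)) | u in unit_sphere].

Definition graphical_derivative Phi (z : V * Y) : V -> set Y :=
  fun p => [set v | contingent_cone (graph_of Phi) z (p, v)].

End SetValuedMappings.

Section ParameterizedInclusion.
Context {R : realType} {P X Y : normedModType R}.

Definition solution_map (F : P * X -> set Y) (C : set Y) : P -> set X :=
  fun p => [set x | F (p, x) `<=` C].

(* H p x u stands for H_{F(p,.)}(x; u). *)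
Definition sigma_inf (F : P * X -> set Y) (C : set Y) (H : P -> X -> X -> set Y)
    (pbar : P) (xbar : X) (delta : R) : \bar R :=
  ereal_inf
    [set sigma_prederivative C (H z.1 z.2)
      | z in (closed_ball_ normr pbar delta `*` closed_ball_ normr xbar delta)
             `\` graph_of (solution_map F C)].

End ParameterizedInclusion.

(* Main.v *)
Require Import Defs.
From mathcomp Require Import all_boot all_order all_algebra.
From mathcomp Require Import all_classical all_reals all_analysis.
From mathcomp Require Import ring lra.

Import Order.TTheory GRing.Theory Num.Def Num.Theory.
Import numFieldNormedType.Exports.

Local Open Scope classical_set_scope.
Local Open Scope ring_scope.

(** Let e(p, x) be the excess of F(p, x) beyond C, the supremum of the distances
to C of the points of F(p, x).  It vanishes exactly on the graph of the solution
mapping S.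

The main step is an error bound: for p near pbar and x near xbar, the distance
from x to S(p) is at most e(p, x) / s when this excess is small, where s > 0
is any number smaller than the infimum of the constants sigma. If e(p, x) > 0,
there is a unit vector u such that H(u) lies in C together with an
r-neighbourhood, for some r > s, where H is the prederivative of F(p, .) at x.
Moving from x to x + t u adds to each point of F(p, x) a vector of t H(u), up
to an error (r - s) t, and such a vector remains in C after any perturbation
of norm at most s t. A convex cone is stable under sums, so the perturbation
can be spent on approaching C, and the excess drops by s t (dist_set_addr,
excess_descent). As F(p, .) is lower semicontinuous, so is its excess, and
Ekeland's variational principle in the Banach space X produces a point at
distance at most e(p, x) / s from x at which no such descent is possible; that
point is a solution (ekeland, zero_of_descent).

Now let HF(p, v) be contained in C.  The prederivative of F at (pbar, xbar) shows
that F (pbar + t p, xbar + t v) lies in C + t C + o(t) B, hence within o(t) of C.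
The error bound gives a solution for the parameter pbar + t p within o(t) of
xbar + t v, so (p, v) is tangent to the graph of S. *)

(** * Ekeland's variational principle *)

Section Ekeland.
Context {R : realType} {X : completeNormedModType R}.
Context (f : X -> \bar R) (s : R).
Context (s_gt0 : 0 < s) (f_ge0 : forall x, (0 <= f x)%E).
Context (f_lsc : lower_semicontinuous f).

(** The lower sections of the Ekeland order: a minimal point for this order is
the point wanted. *)
Let below (x : X) : set X := [set y | (f y + (s * `|y - x|)%:E <= f x)%E].

Let below_refl x : below x x.
Proof. by rewrite /below /= subrr normr0 mulr0 adde0. Qed.

Let below_trans x y z : below x y -> below y z -> below x z.
Proof.
rewrite /below /= => yx zy; apply: le_trans yx.
apply: le_trans (_ : (f z + (s * `|z - y|)%:E + (s * `|y - x|)%:E <= _)%E).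
  rewrite -addeA leeD2l// -EFinD lee_fin -mulrDr ler_pM2l//.
  by rewrite (le_trans _ (ler_normD _ _))// addrA subrK.
by rewrite leeD2r.
Qed.

Let below_bound x y : f x \is a fin_num -> below x y ->
  f y \is a fin_num /\ s * `|y - x| <= fine (f x) - fine (f y).
Proof.
rewrite /below /=; move: (f_ge0 y).
by case: (f x) (f y) => [a| |] [b| |]//= _ _; rewrite lee_fin => ?; split=> //; lra.
Qed.

Let below_lim x (v : nat -> X) l : f x \is a fin_num ->
  (\forall n \near \oo, below x (v n)) -> v @ \oo --> l -> below x l.
Proof.
move=> fx vx vl; rewrite /below /= leNgt; apply/negP => fxl.
(* A real a slightly below f l: by semicontinuity f (v n) stays above a, which
   contradicts v n in below x once `|v n - x| is close to `|l - x|. *)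
have [a] : exists2 a : R, (a%:E < f l)%E & fine (f x) < a + s * `|l - x|.
  move: fxl fx (f_ge0 l); case: (f x) => //= b; case: (f l) => //=.
    move=> c; rewrite lte_fin => bc _ _.
    exists ((b - s * `|l - x| + c) / 2); rewrite ?lte_fin; lra.
  by move=> _ _ _; exists (b - s * `|l - x| + 1); rewrite ?ltry//; lra.
move=> /f_lsc [V Vl Va] fxa.
have vlx : (fun n => a + s * `|v n - x|) @ \oo --> a + s * `|l - x|.
  apply: cvgD; first exact: cvg_cst.
  apply: cvgMl_tmp; apply: cvg_norm; apply: cvgB => //; exact: cvg_cst.
have [n [nV nx na]] : exists n, [/\ V (v n), below x (v n) &
    fine (f x) < a + s * `|v n - x|].
  have nn : \forall n \near \oo, [/\ V (v n), below x (v n) &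
      fine (f x) < a + s * `|v n - x|].
    near=> n; split.
    - by near: n; exact: vl.
    - by near: n.
    - by near: n; exact: (cvgr_gt _ vlx).
  by have /filter_ex := nn.
have [fv] := below_bound _ _ fx nx.
have := Va _ nV; case: (f (v n)) fv => //= c _; rewrite lte_fin; lra.
Unshelve. all: by end_near. Qed.

(** Each step of the iteration goes at least half as far as any point
below x.  Hence, once the steps tend to 0, so do the diameters of the sets of
points below the iterates. *)
Let far_below x : exists y, f x \is a fin_num ->
  below x y /\ forall z, below x z -> `|z - x| <= 2 * `|y - x|.
Proof.
have [fx|] := boolP (f x \is a fin_num); last by exists x.
pose D := [set `|y - x| | y in below x].
have D0 : has_sup D.
  split; first by exists 0, x => //; rewrite subrr normr0.
  exists (fine (f x) / s) => _ [y yx <-].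
  have [fy] := below_bound _ _ fx yx.
  rewrite ler_pdivlMr// mulrC => /le_trans; apply.
  by rewrite gerBl fine_ge0.
have [sup0|sup0] := leP (sup D) 0.
  exists x => _; split=> // z zx; rewrite subrr normr0 mulr0.
  by apply: le_trans sup0; apply: ub_le_sup; [case: D0 | exists z].
have [_ [y yx <-] ysup] := sup_adherent (divr_gt0 sup0 (ltr0n R 2)) D0.
exists y => _; split=> // z zx.
have : `|z - x| <= sup D by apply: ub_le_sup; [case: D0 | exists z].
lra.
Qed.

(** The real sequence f (u n) is nonincreasing and bounded below, so it converges,
and s * `|u n - u m| is bounded by its increments; thus u is Cauchy.  Its limit is
below every iterate, and a point below the limit is below every iterate too, so
by the choice of the steps it is the limit itself. *)
Lemma ekeland (x0 : X) : f x0 \is a fin_num ->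
  exists x, (f x + (s * `|x - x0|)%:E <= f x0)%E /\
    forall y, (f y + (s * `|y - x|)%:E <= f x)%E -> y = x.
Proof.
move=> fx0.
have [next nextP] := choice far_below.
pose u n := iter n next x0.
have fu n : f (u n) \is a fin_num.
  elim: n => //= n IH; have [ub _] := nextP _ IH.
  by have [] := below_bound _ _ IH ub.
have uS n : below (u n) (u n.+1) by have [] := nextP _ (fu n).
have ule n m : (n <= m)%N -> below (u n) (u m).
  move=> /subnKC <-; elim: (m - n)%N => [|k IH]; first by rewrite addn0.
  by rewrite addnS; exact: below_trans _ _ _ IH (uS _).
have g_noninc : nonincreasing_seq (fun n => fine (f (u n))).
  move=> n m nm; have [_] := below_bound _ _ (fu n) (ule _ _ nm).
  by have := mulr_ge0 (ltW s_gt0) (normr_ge0 (u m - u n)); lra.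
have g_cvg : cvgn (fun n => fine (f (u n))).
  apply: nonincreasing_is_cvgn => //.
  by exists 0 => _ [n _ <-]; rewrite fine_ge0.
have u_cvg : cvgn u.
  apply/cauchy_cvgP/cauchy_exP => e e0.
  have /cvgrPdist_lt/(_ _ (mulr_gt0 s_gt0 e0)) [N _ /(_ N (leqnn N)) gN] := g_cvg.
  exists (u N), N => // m /= Nm.
  have [_] := below_bound _ _ (fu N) (ule _ _ Nm).
  have := nonincreasing_cvgn_ge g_noninc g_cvg m.
  rewrite -ball_normE /ball_ /= distrC -(ltr_pM2l s_gt0).
  by move: gN; rewrite ltr_norml => /andP[]; lra.
have ul : u @ \oo --> limn u by exact: u_cvg.
have below_l n : below (u n) (limn u).
  by apply: below_lim (fu n) _ ul; exists n => // m /=; exact: ule.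
exists (limn u); split; first exact: (below_l 0%N).
move=> y yl; apply/eqP; rewrite -subr_eq0 -normr_le0 leNgt; apply/negP => d0.
have d5 : 0 < `|y - limn u| / 5 by lra.
have [N _ uN] := cvgr_dist_lt _ _ ul _ d5.
have := uN N (leqnn N); have := uN N.+1 (leqnSn N); rewrite /= => uN1 uN0.
have [_ /(_ y (below_trans _ _ _ (below_l N) yl)) yuN] := nextP _ (fu N).
have := ler_distD (u N) y (limn u).
have := ler_distD (limn u) (next (u N)) (u N).
rewrite [`|u N - limn u|]distrC [`|next (u N) - limn u|]distrC; lra.
Qed.
End Ekeland.
(** * The excess beyond a convex cone *)

Section Excess.
Context {R : realType} {Y : normedModType R}.
Implicit Types (C A : set Y) (y : Y).

Lemma dist_set_ge0 y C : (0 <= dist_set y C)%E.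
Proof. by apply: le_ereal_inf_tmp => _ [z _ <-]; rewrite lee_fin. Qed.

Lemma dist_set_lt y C (r : R) :
  (dist_set y C < r%:E)%E -> exists2 z, C z & `|y - z| < r.
Proof. by move=> /ereal_inf_lt[_ [z Cz <-]]; rewrite lte_fin; exists z. Qed.

Lemma dist_set_le y C z : C z -> (dist_set y C <= `|y - z|%:E)%E.
Proof. by move=> Cz; apply: ereal_inf_lbound; exists z. Qed.

(** Only semicontinuity is stated, because the distance to the empty set is
infinite. *)
Lemma dist_set_lsc C : lower_semicontinuous (fun y => dist_set y C).
Proof.
move=> y a ay.
have [b ab bC] : exists2 b : R, a < b & forall z, C z -> b <= `|y - z|.
  have := dist_set_le y C; move: ay; case: (dist_set y C) => [c| |] //.
    by rewrite lte_fin => ac yC; exists c.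
  by move=> _ yC; exists (a + 1); [lra | move=> z /yC].
exists (ball y ((b - a) / 2)).
  by apply: nbhsx_ballx; rewrite divr_gt0// subr_gt0.
move=> y'; rewrite -ball_normE /ball_ /= => yy'.
apply: (@lt_le_trans _ _ ((a + b) / 2)%:E); first by rewrite lte_fin; lra.
apply: le_ereal_inf_tmp => _ [z Cz <-]; rewrite lee_fin.
have := bC z Cz; have := ler_distD y' y z; lra.
Qed.

Lemma dist_set_le0 y C : closed C -> (dist_set y C <= 0)%E -> C y.
Proof.
move=> cC yC; apply: cC => B /nbhs_ballP [e /= e0 eB].
have [z Cz yz] : exists2 z, C z & `|y - z| < e.
  by apply: dist_set_lt; apply: le_lt_trans yC _; rewrite lte_fin.
by exists z; split=> //; apply: eB; rewrite -ball_normE.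
Qed.

Definition excess A C : \bar R := ereal_sup [set dist_set y C | y in A].

Lemma excess_leP A C (r : \bar R) :
  (excess A C <= r)%E <-> forall y, A y -> (dist_set y C <= r)%E.
Proof.
split=> [Ar y Ay|Ar]; last by apply: ge_ereal_sup => _ [y Ay <-]; exact: Ar.
by apply: le_trans Ar; apply: ereal_sup_ubound; exists y.
Qed.

Lemma excess_ge0 A C : A !=set0 -> (0 <= excess A C)%E.
Proof.
move=> [y Ay]; apply: le_trans (dist_set_ge0 y C) _.
by apply: ereal_sup_ubound; exists y.
Qed.

Lemma excess_le0 A C : closed C -> (excess A C <= 0)%E -> A `<=` C.
Proof. by move=> cC /excess_leP AC y /AC; exact: dist_set_le0. Qed.

Lemma excess_lsc {V : normedModType R} (Phi : V -> set Y) C :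
  (forall x, lsc_at Phi x) -> lower_semicontinuous (fun x => excess (Phi x) C).
Proof.
move=> Phi_lsc x a /ereal_sup_gt[_ [y xy <-] ay].
have oO : open [set y | (a%:E < dist_set y C)%E].
  by have /lower_semicontinuousP := dist_set_lsc C; exact.
have := Phi_lsc x _ oO; move=> /(_ (ex_intro _ y (conj xy ay))) xO.
exists [set x' | Phi x' `&` [set y | (a%:E < dist_set y C)%E] !=set0] => //.
move=> x' [y' [xy' ay']]; apply: lt_le_trans ay' _.
by apply: ereal_sup_ubound; exists y'.
Qed.

Lemma convex_cone_add C : convex_set (C : set (convex_lmodType Y)) ->
  is_cone C -> forall a b, C a -> C b -> C (a + b).
Proof.
move=> convC coneC a b Ca Cb.
have h0 : 0 <= (2^-1 : R) by rewrite invr_ge0.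
have h1 : (2^-1 : R) <= 1 by rewrite invf_le1 ?ler1n.
have := convC a b (Itv01 h0 h1).
rewrite !inE => /(_ Ca Cb) Cab.
have := coneC 2 _ (ltr0n R 2) Cab.
rewrite -[X in 2 *: X]/(2^-1 *: a + (1 - 2^-1) *: b).
have -> : 1 - 2^-1 = 2^-1 :> R by lra.
by rewrite -scalerDr scalerA mulfV ?pnatr_eq0// scale1r.
Qed.

(** If c in C is nearly closest to a, then a - c splits into a part of norm at
most r, which h absorbs without leaving C, and a remainder of norm about e - r:
adding c yields a point of C which differs from a + h by that remainder only. *)
Lemma dist_set_addr C a h (e r : R) : convex_set (C : set (convex_lmodType Y)) ->
  is_cone C -> 0 <= r <= e -> (dist_set a C <= e%:E)%E ->
  (forall b, `|b| <= r -> C (h + b)) -> (dist_set (a + h)%R C <= (e - r)%:E)%E.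
Proof.
move=> convC coneC /andP[r0 re] aC hC; apply/lee_addgt0Pr => d d0.
have ed0 : 0 < e + d by lra.
have [c Cc ac] : exists2 c, C c & `|a - c| < e + d.
  by apply: dist_set_lt; apply: le_lt_trans aC _; rewrite lte_fin; lra.
pose k := r / (e + d).
have k0 : 0 <= k by rewrite divr_ge0// ltW.
have k1 : k <= 1 by rewrite ler_pdivrMr//; lra.
have kE : k * (e + d) = r by rewrite mulfVK// gt_eqF.
have kac : C (h + k *: (a - c)).
  apply: hC; rewrite normrZ ger0_norm// -kE; apply: ler_wpM2l => //; exact: ltW.
apply: le_trans (dist_set_le _ _ _ (convex_cone_add _ convC coneC _ _ Cc kac)) _.
rewrite -EFinD lee_fin.
have -> : a + h - (c + (h + k *: (a - c))) = (1 - k) *: (a - c).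
  by rewrite scalerBl scale1r (opprD c) (opprD h) addrACA [h + _]addrA subrr add0r.
rewrite normrZ ger0_norm; last lra.
apply: le_trans (_ : (1 - k) * (e + d) <= _); last by rewrite mulrBl kE; lra.
by apply: ler_wpM2l; [lra | exact: ltW].
Qed.

End Excess.

(** * Error bound from a uniform descent condition *)

Section Zero.
Context {R : realType} {X : completeNormedModType R}.

(** An Ekeland point reached from x1 admits no descent.  Its distance to x1 is
at most e / s, which keeps it in the ball of center x0 where descent is possible
unless f vanishes; so f vanishes there. *)
Lemma zero_of_descent (f : X -> \bar R) (s e r : R) (x0 x1 : X) :
  0 < s -> (forall x, (0 <= f x)%E) -> lower_semicontinuous f ->
  (f x1 <= e%:E)%E -> `|x0 - x1| + e / s <= r ->
  (forall x, `|x0 - x| <= r -> (0 < f x)%E -> f x \is a fin_num ->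
     exists2 y, y != x & (f y + (s * `|y - x|)%:E <= f x)%E) ->
  exists2 x, f x = 0%E & `|x - x1| <= e / s.
Proof.
move=> s0 f0 lscf fe er descent.
have fx1 : f x1 \is a fin_num by rewrite ge0_fin_numE// (le_lt_trans fe)// ltry.
have [x [xx1 xmin]] := ekeland _ _ s0 f0 lscf x1 fx1.
have fx : f x \is a fin_num.
  rewrite ge0_fin_numE//; apply: le_lt_trans (ltry (fine (f x1))); rewrite fineK//.
  by apply: le_trans xx1; rewrite leeDl// lee_fin mulr_ge0// ltW.
have xe : `|x - x1| <= e / s.
  rewrite ler_pdivlMr// mulrC -lee_fin; apply: le_trans fe; apply: le_trans xx1.
  by rewrite leeDr.
exists x => //; apply/eqP; rewrite eq_le f0 andbT leNgt; apply/negP => fx0.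
have [|y /eqP yx /xmin//] := descent x _ fx0 fx.
have := ler_distD x1 x0 x; rewrite [`|x1 - x|]distrC; lra.
Qed.

End Zero.

(** * Descent of the excess along a prederivative *)

Section Descent.
Context {R : realType} {X Y : normedModType R}.

Lemma unit_ballE (b : Y) : unit_ball b = (`|b| <= 1).
Proof. by rewrite /unit_ball /closed_ball_ /= sub0r normrN. Qed.

Lemma ball_scale (b : Y) (r : R) : 0 < r -> `|b| <= r ->
  exists2 b', unit_ball b' & b = r *: b'.
Proof.
move=> r0 br; exists (r^-1 *: b); last by rewrite scalerA mulfV ?gt_eqF// scale1r.
rewrite unit_ballE normrZ gtr0_norm ?invr_gt0//.
by rewrite ler_pdivrMl// mulr1.
Qed.

Lemma sigma_prederivative_gt (C : set Y) (H : X -> set Y) (s : R) :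
  0 < s -> (s%:E < sigma_prederivative C H)%E ->
  exists u r, [/\ `|u| = 1, s < r &
    forall h b, H u h -> `|b| <= r -> C (h + b)].
Proof.
move=> s0 /ereal_sup_gt[_ [u u1 <-]] /ereal_sup_gt[_ [r [r0 rC] <-]].
rewrite lte_fin => sr; exists u, r; split=> // h b uh br.
have [b' b'1 ->] := ball_scale _ _ r0 br.
have /rC : set_scale r unit_ball (r *: b') by exists b'.
by apply; exists (r *: b') => //; exists h => //; exact: addrC.
Qed.

(** The prederivative is used with error r - s: the r-neighbourhood of H u inside
C absorbs this error and leaves room for perturbations of norm s. *)
Lemma excess_descent (C : set Y) (Phi H : X -> set Y) (x : X) (s : R) :
  convex_set (C : set (convex_lmodType Y)) -> is_cone C ->
  outer_prederivative Phi x H -> 0 < s -> (s%:E < sigma_prederivative C H)%E ->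
  (0 < excess (Phi x) C)%E -> excess (Phi x) C \is a fin_num ->
  exists2 y, y != x &
    (excess (Phi y) C + (s * `|y - x|)%:E <= excess (Phi x) C)%E.
Proof.
move=> convC coneC [Hhom Hpre] s0 /(sigma_prederivative_gt _ _ _ s0)[u [r [u1 sr urC]]].
move=> xC0 /fineK xCE; set e := fine _ in xCE.
have e0 : 0 < e by rewrite -lte_fin xCE.
have rs0 : 0 < r - s by rewrite subr_gt0.
have [d d0 Phid] := Hpre _ rs0.
(* The bound e / s keeps the drop s * t below the current excess e. *)
pose t := minr d (e / s).
have t0 : 0 < t by rewrite lt_min d0 divr_gt0.
have te : s * t <= e by rewrite mulrC -ler_pdivlMr// ge_min lexx orbT.
have tu : `|t *: u| = t by rewrite normrZ u1 mulr1 gtr0_norm.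
exists (x + t *: u); first by rewrite -subr_eq0 addrAC subrr add0r -normr_gt0 tu.
rewrite addrAC subrr add0r tu -xCE -leeBrDr// -EFinB.
apply/excess_leP => w /Phid.
rewrite /closed_ball_ /= opprD addrA subrr sub0r normrN tu ge_min lexx => /(_ isT).
rewrite addrAC subrr add0r Hhom// tu.
move=> [_ [a xa [_ [h uh <-] <-]] [_ [b b1 <-] <-]].
rewrite -addrA; apply: dist_set_addr => //.
- by rewrite te mulr_ge0// ltW.
- by have /excess_leP := lexx (excess (Phi x) C); rewrite -xCE; exact.
move=> b' b's.
have -> : t *: h + ((r - s) * t) *: b + b' = t *: (h + ((r - s) *: b + t^-1 *: b')).
  by rewrite !scalerDr !scalerA mulfV ?gt_eqF// scale1r [t * _]mulrC addrA.
apply: coneC => //; apply: urC => //.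
apply: le_trans (ler_normD _ _) _.
rewrite !normrZ (gtr0_norm rs0) gtr0_norm ?invr_gt0//.
have {}b's : t^-1 * `|b'| <= s by rewrite ler_pdivrMl// mulrC.
have {}b1 : (r - s) * `|b| <= (r - s) * 1.
  apply: ler_wpM2l; first exact: ltW.
  by rewrite -unit_ballE.
lra.
Qed.

End Descent.

(** * Tangent directions *)

Section ContingentCone.
Context {R : realType} {V : normedModType R}.

Lemma contingent_cone_near (S : set V) (y v : V) :
  (forall eps : R, 0 < eps -> \forall t \near (0 : R)^'+,
     exists2 z, S z & `|y + t *: v - z| <= eps * t) ->
  contingent_cone S y v.
Proof.
move=> yvS; rewrite /contingent_cone /= limf_einfE; apply/eqP; rewrite eq_le.
apply/andP; split; last first.
  apply: le_ereal_sup_tmp.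
  exists (ereal_inf ((fun t : R => dist_set (y + t *: v)%R S * (t^-1)%R%:E)%E
                       @` [set t | 0 < t])).
    by exists [set t | 0 < t] => //; exact: nbhs_right_gt.
  apply: le_ereal_inf_tmp => _ [t /= t0 <-].
  by rewrite mule_ge0// ?dist_set_ge0// lee_fin invr_ge0 ltW.
apply: ge_ereal_sup => _ [B B0 <-].
apply/lee_addgt0Pr => eps eps0; rewrite add0e.
have [t [tB t0 [z Sz yz]]] : exists t, [/\ B t, 0 < t &
    exists2 z, S z & `|y + t *: v - z| <= eps * t].
  have tt : \forall t \near (0 : R)^'+, [/\ B t, 0 < t &
    exists2 z, S z & `|y + t *: v - z| <= eps * t].
    near=> t; split; first by near: t.
      by near: t; exact: nbhs_right_gt.
    by near: t; exact: yvS.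
  by have /filter_ex := tt.
apply: ge_ereal_inf; exists (dist_set (y + t *: v)%R S * (t^-1)%R%:E)%E.
  by exists t.
rewrite lee_pdivrMr //.
apply: le_trans (dist_set_le _ _ _ Sz) _.
by rewrite -EFinM lee_fin.
Unshelve. all: by end_near. Qed.

End ContingentCone.

(** * The graphical derivative of the solution mapping *)

Theorem theorem4p9 (R : realType) (P Y : normedModType R)
    (X : completeNormedModType R)
    (C : set Y) (F : P * X -> set Y)
    (C_closed : closed C)
    (C_convex : convex_set (C : set (convex_lmodType Y)))
    (C_cone : is_cone C)
    (C_int : interior C !=set0)
    (F_nonempty : forall z : P * X, F z !=set0)
    (pbar : P) (xbar : X)
    (HF : P * X -> set Y)
    (h_i : solution_map F C pbar xbar)
    (h_ii : hausdorff_usc_at C (fun p : P => F (p, xbar)) pbar)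
    (h_iii : exists2 delta1 : R, 0 < delta1 &
       forall p : P, closed_ball_ normr pbar delta1 p ->
         forall x : X, lsc_at (fun x' : X => F (p, x')) x)
    (h_iv : exists2 delta2 : R, 0 < delta2 &
       exists2 H : P -> X -> X -> set Y,
         (forall p : P, closed_ball_ normr pbar delta2 p ->
          forall x : X, closed_ball_ normr xbar delta2 x ->
            outer_prederivative (fun x' : X => F (p, x')) x (H p x)) &
         (0 < sigma_inf F C H pbar xbar delta2)%E)
    (h_v : outer_prederivative F (pbar, xbar) HF) :
  forall p : P,
    [set v : X | HF (p, v) `<=` C]
      `<=` graphical_derivative (solution_map F C) (pbar, xbar) p.
Proof.
move=> p v /= HFC; apply: contingent_cone_near => eps eps0.
have [d1 d1_gt0 F_lsc] := h_iii.
have [d2 d2_gt0 [H H_pre sigma_gt0]] := h_iv.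
have [s s0 s_sigma] : exists2 s : R, 0 < s & (s%:E < sigma_inf F C H pbar xbar d2)%E.
  move: sigma_gt0; case: (sigma_inf _ _ _ _ _ _) => [c| |]//.
    by rewrite lte_fin => c0; exists (c / 2); rewrite ?lte_fin; lra.
  by move=> _; exists 1; rewrite ?ltry.
have [HF_hom HF_pre] := h_v.
set N := `|(p, v)|.
have N0 : 0 <= N by exact: normr_ge0.
(* With this error for the prederivative of F, the excess at (pt, xt) is at most
   s * (eps * t); the summand 1 covers the case (p, v) = 0. *)
have k0 : 0 < s * eps / (N + 1) by rewrite divr_gt0 ?mulr_gt0//; lra.
have [d d_gt0 Fd] := HF_pre _ k0.
near=> t.
have t0 : 0 < t by near: t; exact: nbhs_right_gt.
have t_small : t * (N + eps) <= minr d (minr d1 d2).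
  rewrite -ler_pdivlMr; last lra.
  near: t; apply: nbhs_right_le; rewrite divr_gt0 ?lt_min ?d_gt0 ?d1_gt0//; lra.
have [td td1 td2] : [/\ t * (N + eps) <= d, t * (N + eps) <= d1 &
    t * (N + eps) <= d2].
  by move: t_small; rewrite !le_min => /andP[-> /andP[-> ->]].
have tN0 : 0 <= t * N by rewrite mulr_ge0// ltW.
have teps : 0 < t * eps by rewrite mulr_gt0.
rewrite mulrDr in td td1 td2.
have pN : t * `|p| <= t * N by rewrite ler_pM2l// /N prod_normE le_max lexx.
have vN : t * `|v| <= t * N.
  by rewrite ler_pM2l// /N prod_normE le_max lexx orbT.
pose pt := pbar + t *: p; pose xt := xbar + t *: v.
have pt_near r : t * N <= r -> closed_ball_ normr pbar r pt.
  move=> tr; rewrite /closed_ball_ /= opprD addrA subrr sub0r normrN normrZ gtr0_norm//.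
  exact: le_trans tr.
have xt_norm : `|xbar - xt| = t * `|v|.
  by rewrite /xt opprD addrA subrr sub0r normrN normrZ gtr0_norm.
have excess_t : (excess (F (pt, xt)) C <= (s * (eps * t))%:E)%E.
  apply/excess_leP => w.
  have tN : `|t *: (p, v)| = t * N by rewrite normrZ gtr0_norm.
  have /Fd : closed_ball_ normr (pbar, xbar) d ((pbar, xbar) + t *: (p, v)).
    rewrite /closed_ball_ /= opprD addrA subrr sub0r normrN tN; lra.
  rewrite addrAC subrr add0r HF_hom// tN => /(_ w)/[apply].
  move=> [_ [a Fa [_ [h HFh <-] <-]] [_ [b b1 <-] <-]].
  have Cah : C (a + t *: h).
    by apply: convex_cone_add => //; [exact: h_i | apply: C_cone => //; exact: HFC].
  apply: le_trans (dist_set_le _ _ _ Cah) _.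
  rewrite lee_fin addrAC subrr add0r normrZ (ger0_norm (mulr_ge0 (ltW k0) tN0)).
  move: b1; rewrite unit_ballE => b1.
  apply: le_trans (_ : s * eps / (N + 1) * (t * N) * 1 <= _).
    by apply: ler_wpM2l => //; exact: mulr_ge0 (ltW k0) tN0.
  rewrite mulr1 (_ : _ * (t * N) = s * (eps * t) * (N / (N + 1))); last by field; lra.
  apply: ler_piMr; first by rewrite !mulr_ge0// ltW.
  by rewrite ler_pdivrMr; lra.
have [x x_zero x_near] : exists2 x, excess (F (pt, x)) C = 0%E &
    `|x - xt| <= s * (eps * t) / s.
  apply: (@zero_of_descent _ _ (fun x => excess (F (pt, x)) C) s _ d2 xbar) => //.
  - by move=> x; exact: excess_ge0.
  - by apply: excess_lsc; apply: F_lsc; apply: pt_near; lra.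
  - by rewrite mulrAC mulfV ?gt_eqF// mul1r xt_norm [eps * t]mulrC; lra.
  move=> x xd2 x_pos x_fin.
  have pt_d2 : closed_ball_ normr pbar d2 pt by apply: pt_near; lra.
  apply: (@excess_descent _ _ _ _ (fun x => F (pt, x)) (H pt x)) => //.
    exact: H_pre.
  apply: (lt_le_trans s_sigma); apply: ereal_inf_lbound; exists (pt, x) => //=.
  split=> // xS; move: x_pos; apply/negP; rewrite -leNgt.
  apply/excess_leP => w /xS Cw; apply: le_trans (dist_set_le _ _ _ Cw) _.
  by rewrite subrr normr0.
exists (pt, x).
  by apply: excess_le0 => //; rewrite x_zero.
rewrite prod_normE ge_max /= subrr normr0 [eps * t]mulrC (ltW teps) /= -/xt.
by rewrite distrC (le_trans x_near)// mulrAC mulfV ?gt_eqF// mul1r mulrC.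
Unshelve. all: by end_near. Qed.
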